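(* Let $n\ge2$. Suppose $T<T'$ in $\mathscr{C}_n$ and $\mathrm{rank}(T')-\mathrm{rank}(T)=k$. Then $$|\mathrm{ParseWords}(T,T')|=3\cdot 2^{n-1-k}.$$
   Context: $\mathbb{T}_n$ is the set of all full plane binary trees with $n$ leaves (every internal vertex has exactly a left child and a right child); the leaves are labeled $a_1,\ldots,a_n$ from left to right. For $T\in\mathbb{T}_n$, the reduced parenthesization $RP_T$ is the set of all subsets of $\{a_1,\ldots,a_n\}$ which are leaf sets of the subtrees of $T$ rooted at vertices of $T$ and which do not contain $a_n$. Elements of $RP_T$ of cardinality greater than $1$ are called parenthesis pairs. The (right) comb poset $\mathscr{C}_n$ is the set $\mathbb{T}_n$ ordered by $T_1\le T_2$ if and only if $RP_{T_1}\subseteq RP_{T_2}$. $\mathscr{C}_n$ is ranked, and $\mathrm{rank}(T)$, the rank of $T$ in $\mathscr{C}_n$, equals the number of parenthesis pairs in $RP_T$. A word $w=w_1\cdots w_n\in\{0,1,2\}^n$ is parsed by $T\in\mathbb{T}_n$ if the labeling of the leaves of $T$ by $w_1,\ldots,w_n$ from left to right extends to a labeling of all $2n-1$ vertices of $T$ by $\{0,1,2\}$ such that the two children of each internal vertex have distinct labels and no parent and child have the same label. $\mathrm{ParseWords}(T_1,\ldots,T_m)$ is the set of words $w\in\{0,1,2\}^n$ parsed by all of $T_1,\ldots,T_m$. *)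

(* Defs.v *)
From HB Require Import structures.
From mathcomp Require Import all_boot all_order zify.

Set Implicit Arguments.
Unset Strict Implicit.
Unset Printing Implicit Defensive.

Import Order.TTheory.

Inductive bintree := Leaf | Node of bintree & bintree.

Fixpoint nleaves (t : bintree) : nat :=
  if t is Node l r then nleaves l + nleaves r else 1.

(* A prefix code, only used to get the countType and finType structures. *)
Fixpoint encode (t : bintree) : seq bool :=
  if t is Node l r then true :: encode l ++ encode r else [:: false].

Definition decode_step (b : bool) (st : seq bintree) : seq bintree :=
  if b then (if st is l :: r :: st' then Node l r :: st' else st)
  else Leaf :: st.

Definition decode (s : seq bool) : option bintree :=
  ohead (foldr decode_step [::] s).

Lemma foldr_encode t st : foldr decode_step st (encode t) = t :: st.
Proof.
elim: t st => [|l IHl r IHr] st //=.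
by rewrite foldr_cat IHr IHl.
Qed.

Lemma encodeK : pcancel encode decode.
Proof. by move=> t; rewrite /decode foldr_encode. Qed.

Lemma size_encode t : size (encode t) = (nleaves t).*2.-1.
Proof.
have E u : (size (encode u)).+1 = (nleaves u).*2.
  elim: u => [|l IHl r IHr] //=.
  by rewrite size_cat doubleD -IHl -IHr addSn addnS.
by rewrite -E.
Qed.

HB.instance Definition _ := Countable.copy bintree (pcan_type encodeK).

(* The set T_n. *)
Record ptree (n : nat) :=
  PTree { tree_of :> bintree; tree_ofP : nleaves tree_of == n }.

HB.instance Definition _ n := [isSub for @tree_of n].
HB.instance Definition _ n := [Countable of ptree n by <:].

Lemma ptree_code_subproof n (t : ptree n) : size (encode t) == n.*2.-1.
Proof. by rewrite size_encode (eqP (tree_ofP t)). Qed.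

Definition ptree_code n (t : ptree n) : n.*2.-1.-tuple bool :=
  Tuple (ptree_code_subproof t).

Definition ptree_decode n (s : n.*2.-1.-tuple bool) : option (ptree n) :=
  obind insub (decode s).

Lemma ptree_codeK n : pcancel (@ptree_code n) (@ptree_decode n).
Proof. by move=> t; rewrite /ptree_decode /= encodeK /= valK. Qed.

HB.instance Definition _ n : isFinite (ptree n) :=
  PCanIsFinite (@ptree_codeK n).

(* All the subtrees of t rooted at vertices of t, each paired with the index
   of its leftmost leaf, the leftmost leaf of t itself having index i. *)
Fixpoint subtrees (i : nat) (t : bintree) : seq (nat * bintree) :=
  (i, t) ::
  if t is Node l r then subtrees i l ++ subtrees (i + nleaves l) r else [::].

(* The leaves a_1, ..., a_n are represented by 'I_n, hence indexed from 0. *)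
Definition leaf_set n (p : nat * bintree) : {set 'I_n} :=
  [set j : 'I_n | p.1 <= j < p.1 + nleaves p.2].

(* The condition j.+1 != n says that the leaf j is not the last leaf a_n. *)
Definition RP n (t : ptree n) : {set {set 'I_n}} :=
  [set A in [seq leaf_set n p | p <- subtrees 0 t]
     | [forall j in A, j.+1 != n]].

Definition parenthesis_pairs n (t : ptree n) : {set {set 'I_n}} :=
  [set A in RP t | 1 < #|A|].

Lemma nleaves_gt0 t : 0 < nleaves t.
Proof. by elim: t => //= l Hl r _; rewrite addn_gt0 Hl. Qed.

Definition spans (i : nat) (t : bintree) : seq (nat * nat) :=
  [seq (p.1, nleaves p.2) | p <- subtrees i t].

Lemma spans_Node i l r : spans i (Node l r) =
  (i, nleaves l + nleaves r) :: spans i l ++ spans (i + nleaves l) r.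
Proof. by rewrite /spans /= map_cat. Qed.

Lemma spans_bound i t s m : (s, m) \in spans i t ->
  [/\ i <= s, s + m <= i + nleaves t & 0 < m].
Proof.
elim: t i => [|l IHl r IHr] i.
  by rewrite inE => /eqP [-> ->].
rewrite spans_Node inE mem_cat => /or3P [/eqP [-> ->]|/IHl|/IHr] /=.
- by rewrite leqnn addn_gt0 nleaves_gt0.
- by case=> h1 h2 h3; split=> //; apply: leq_trans h2 _; rewrite addnA leq_addr.
case=> h1 h2 h3; split=> //; last by rewrite addnA.
by apply: leq_trans h1; apply: leq_addr.
Qed.

Lemma spans_root i t : (i, nleaves t) \in spans i t.
Proof. by case: t => [|l r]; rewrite inE eqxx. Qed.

Lemma spans_Node_l i l r s m : s + m <= i + nleaves l ->
  ((s, m) \in spans i (Node l r)) = ((s, m) \in spans i l).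
Proof.
move=> h; rewrite spans_Node inE mem_cat; apply/or3P/idP => [[]//|->].
- move=> /eqP [es em]; move: h; rewrite es em leq_add2l -{2}[nleaves l]addn0.
  by rewrite leq_add2l leqNgt nleaves_gt0.
- case/spans_bound => h1 _ h3; have := leq_trans h h1.
  by rewrite -{2}[s]addn0 leq_add2l leqNgt h3.
by constructor 2.
Qed.

Lemma spans_Node_r i l r s m : i + nleaves l <= s ->
  ((s, m) \in spans i (Node l r)) = ((s, m) \in spans (i + nleaves l) r).
Proof.
move=> h; rewrite spans_Node inE mem_cat; apply/or3P/idP => [[]//|->].
- move=> /eqP [es em]; move: h; rewrite es -{2}[i]addn0.
  by rewrite leq_add2l leqNgt nleaves_gt0.
- case/spans_bound => _ h2 h3; have := leq_trans h2 h.
  by rewrite -{2}[s]addn0 leq_add2l leqNgt h3.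
by constructor 3.
Qed.

Lemma spans_inj i t u : nleaves t = nleaves u ->
  (forall s m, s + m < i + nleaves t ->
     ((s, m) \in spans i t) = ((s, m) \in spans i u)) ->
  t = u.
Proof.
elim: t i u => [|l IHl r IHr] i [|l' r'] //=.
- move=> e; have := leq_add (nleaves_gt0 l') (nleaves_gt0 r').
  by rewrite -e.
- move=> e; have := leq_add (nleaves_gt0 l) (nleaves_gt0 r).
  by rewrite e.
move=> e H.
have max_l a b a' b' : nleaves a + nleaves b = nleaves a' + nleaves b' ->
  (i, nleaves a') \in spans i (Node a b) -> nleaves a' <= nleaves a.
  move=> e1; rewrite spans_Node inE mem_cat.
  case/or3P=> [/eqP [e2]|/spans_bound [_ + _]|/spans_bound [+ _ _]].
  - move: (nleaves_gt0 b'); rewrite -(ltn_add2l (nleaves a')) addn0.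
    by rewrite -e1 e2 ltnn.
  - by rewrite leq_add2l.
  by rewrite -{2}[i]addn0 leq_add2l leqNgt nleaves_gt0.
have el : nleaves l = nleaves l'.
  apply/eqP; rewrite eqn_leq; apply/andP; split.
    apply: (max_l l' r' l r) => //; rewrite -H; last first.
      by rewrite ltn_add2l -{1}[nleaves l]addn0 ltn_add2l nleaves_gt0.
    by rewrite spans_Node_l ?spans_root.
  apply: (max_l l r l' r') => //; rewrite H; last first.
    by rewrite e ltn_add2l -{1}[nleaves l']addn0 ltn_add2l nleaves_gt0.
  by rewrite spans_Node_l ?spans_root.
have er : nleaves r = nleaves r' by move/eqP: e; rewrite el eqn_add2l => /eqP.
congr Node.
  apply: (IHl i) => // s m h.
  have h' : s + m < i + (nleaves l + nleaves r).
    by apply: leq_trans h _; rewrite leq_add2l leq_addr.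
  rewrite -(spans_Node_l r (ltnW h)) (H _ _ h') spans_Node_l // -el.
  exact: ltnW.
apply: (IHr (i + nleaves l)) => // s m h.
have [hs|hs] := leqP (i + nleaves l) s.
  rewrite -(spans_Node_r r _ hs) (H s m) ?addnA //.
  by rewrite el in hs *; rewrite spans_Node_r.
by apply/idP/idP=> /spans_bound [] + _ _; rewrite leqNgt hs.
Qed.

Lemma mem_RP_spans n (t : ptree n) s m : s + m < n -> 0 < m ->
  ([set j : 'I_n | s <= j < s + m] \in RP t) = ((s, m) \in spans 0 t).
Proof.
move=> hsm m0; rewrite inE; apply/andP/mapP.
  case=> /mapP [[s' u] hu eA] _; exists (s', u) => //=.
  have /spans_bound : (s', nleaves u) \in spans 0 t.
    by apply/mapP; exists (s', u).
  rewrite (eqP (tree_ofP t)) add0n => -[_ hb u0] {hu}.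
  move: eA => /setP; rewrite /leaf_set /=; move: (nleaves u) u0 hb => m' m'0 hb.
  move=> eA.
  have E j : j < n -> (s <= j < s + m) = (s' <= j < s' + m').
    by move=> hj; have := eA (Ordinal hj); rewrite !inE.
  have bnd x y z : 0 < y -> x + y <= z -> x < z.
    by move=> y0 h; apply: leq_trans h; rewrite -{1}[x]addn0 ltn_add2l.
  have last x y : 0 < y -> (x + y).-1.+1 = x + y.
    by move=> y0; rewrite prednK // addn_gt0 y0 orbT.
  have inl x y : 0 < y -> x <= (x + y).-1 by case: y => // y _; rewrite addnS leq_addr.
  have := E s (bnd _ _ _ m0 (ltnW hsm)).
  have := E s' (bnd _ _ _ m'0 hb).
  rewrite !leqnn !(bnd _ _ _ m0 (leqnn _)) !(bnd _ _ _ m'0 (leqnn _)) /=.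
  move=> /andP [h1 _] /esym/andP [h2 _].
  have es : s = s' by apply/eqP; rewrite eqn_leq h1 h2.
  subst s'; congr pair; apply/eqP; rewrite -(eqn_add2l s) eqn_leq.
  have := E (s + m).-1; have := E (s + m').-1.
  rewrite (last _ _ m0) (last _ _ m'0) (inl _ _ m0) (inl _ _ m'0) !leqnn /=.
  by move=> /(_ hb) -> /(_ (ltnW hsm)) <-.
case=> [[s' u] hu /= [es em]]; split.
  by rewrite es em; apply/mapP; exists (s', u).
apply/forallP=> j; apply/implyP; rewrite inE => /andP [_ h].
by rewrite neq_ltn (leq_ltn_trans h hsm).
Qed.

Lemma RP_inj n : injective (@RP n).
Proof.
move=> t u e; apply: val_inj => /=.
have [et eu] := (eqP (tree_ofP t), eqP (tree_ofP u)).
apply: (@spans_inj 0) => [|s m]; first by rewrite et eu.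
rewrite add0n et => h; have [m0|m0] := posnP m.
  by apply/idP/idP => /spans_bound []; rewrite m0.
by rewrite -!mem_RP_spans // e.
Qed.

Fact comb_display : Order.disp_t. Proof. exact: Order.Disp tt tt. Qed.

Definition comb_le n (t u : ptree n) : bool := RP t \subset RP u.

Lemma comb_le_refl n : reflexive (@comb_le n).
Proof. by move=> t; apply: subxx. Qed.

Lemma comb_le_anti n : antisymmetric (@comb_le n).
Proof. by move=> t u h; apply: RP_inj; apply/eqP; rewrite eqEsubset. Qed.

Lemma comb_le_trans n : transitive (@comb_le n).
Proof. by move=> u t v; apply: subset_trans. Qed.

(* The comb poset C_n. *)
HB.instance Definition _ n := Order.Le_isPOrder.Build comb_display (ptree n)
  (@comb_le_refl n) (@comb_le_anti n) (@comb_le_trans n).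

(* The length (number of elements minus one) of a longest chain with all its
   elements below x. *)
Definition rank d (P : finPOrderType d) (x : P) : nat :=
  \max_(C : {set P} | [forall y in C, (y <= x)%O]
                      && [forall y in C, forall z in C, (y >=< z)%O]) #|C|.-1.

Definition itv n (s m : nat) : {set 'I_n} := [set j : 'I_n | s <= j < s + m].

Lemma mem_RP_itv n (t : ptree n) A : A \in RP t -> exists s m,
  [/\ 0 < m, s + m < n, A = itv n s m & (s, m) \in spans 0 t].
Proof.
rewrite inE => /andP [/mapP [[s u] hu ->] /forallP h].
have hs : (s, nleaves u) \in spans 0 t by apply/mapP; exists (s, u).
have [_ h2 h3] := spans_bound hs.
exists s, (nleaves u); split=> //.
rewrite add0n (eqP (tree_ofP t)) leq_eqVlt in h2; case/orP: h2 => // /eqP h2.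
have hj : (s + nleaves u).-1 < n by lia.
by have /implyP := h (Ordinal hj); rewrite inE /= => /(_ ltac:(lia)); lia.
Qed.

Lemma spans_leaf i t s : i <= s < i + nleaves t -> (s, 1) \in spans i t.
Proof.
elim: t i => [|l IHl r IHr] i /= h.
  by rewrite inE; apply/eqP; congr pair; move=> /=; lia.
rewrite spans_Node inE mem_cat; have [hs|hs] := ltnP s (i + nleaves l).
  by rewrite IHl ?orbT //; lia.
by rewrite IHr ?orbT //; lia.
Qed.

Lemma card_itv_gt1 n s m : s + m < n -> (1 < #|itv n s m|) = (1 < m).
Proof.
move=> h; apply/idP/idP.
  case/card_gt1P=> x [y [+ + hxy]]; rewrite !inE => hx hy.
  by rewrite -val_eqE /= in hxy; lia.
move=> m1; have h0 : s < n by lia.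
have h1 : s.+1 < n by lia.
apply/card_gt1P; exists (Ordinal h0), (Ordinal h1).
by rewrite !inE -val_eqE /=; split; lia.
Qed.

Lemma pairs_sub n (t u : ptree n) :
  (parenthesis_pairs t \subset parenthesis_pairs u) = (t <= u)%O.
Proof.
apply/subsetP/subsetP => h A hA; last first.
  by move: hA; rewrite ![A \in parenthesis_pairs _]inE => /andP [/h -> ->].
have [s [m [m0 hsm eA hm]]] := mem_RP_itv hA.
have [A1|A1] := ltnP 1 #|A|.
  have : A \in parenthesis_pairs u by apply: h; rewrite inE hA.
  by rewrite inE => /andP [].
have m1 : m = 1.
  by move: A1; rewrite eA leqNgt card_itv_gt1 //; lia.
rewrite eA mem_RP_spans // m1; apply: spans_leaf.
by rewrite (eqP (tree_ofP u)); lia.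
Qed.

Lemma card_pairs_lt n (t u : ptree n) : (t < u)%O ->
  #|parenthesis_pairs t| < #|parenthesis_pairs u|.
Proof.
rewrite lt_leAnge -!pairs_sub => /andP [h1 h2].
by apply: proper_card; rewrite properE h1.
Qed.

Lemma rotate i t :
  (forall s m, s + m < i + nleaves t -> (s, m) \in spans i t -> m <= 1) \/
  exists u s0 m0, [/\ nleaves u = nleaves t, 1 < m0, s0 + m0 < i + nleaves t,
    (s0, m0) \notin spans i u &
    forall s m, s + m < i + nleaves t ->
      ((s, m) \in spans i t) = ((s, m) == (s0, m0)) || ((s, m) \in spans i u)].
Proof.
elim: t i => [|l _ r IHr] i.
  by left=> s m _; rewrite inE => /eqP [_ ->].
case: l => [|l1 l2].
  case: (IHr i.+1) => [H|[u [s0 [m0 [e m1 hb hn H]]]]].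
    left=> s m /= h; rewrite spans_Node !(inE, mem_cat) /= addn1.
    case/or3P=> [/eqP [] |/eqP []|]; try lia.
    by apply: H; lia.
  right; exists (Node Leaf u), s0, m0; split=> //=; try lia.
    rewrite spans_Node !(inE, mem_cat) /= addn1 (negPf hn) orbF.
    by apply/negP => /orP [/eqP []|/eqP []]; lia.
  move=> s m h; rewrite !spans_Node !(inE, mem_cat) /= addn1 e (H s m); last lia.
  by do 3 case: (_ == _).
right; exists (Node l1 (Node l2 r)), i, (nleaves l1 + nleaves l2).
have := nleaves_gt0 l1; have := nleaves_gt0 l2; have := nleaves_gt0 r => p1 p2 p3.
split=> /=; try lia.
  apply/negP; rewrite !spans_Node !(inE, mem_cat) /=.
  case/or3P => [/eqP [] |/spans_bound []|]; try lia.
  by case/or3P => [/eqP [] |/spans_bound []|/spans_bound []]; lia.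
move=> s m h; rewrite !spans_Node /= !(inE, mem_cat) addnA.
have -> : ((s, m) == (i, nleaves l1 + nleaves l2 + nleaves r)) = false.
  by apply/eqP=> -[]; lia.
have -> : ((s, m) == (i, nleaves l1 + (nleaves l2 + nleaves r))) = false.
  by apply/eqP=> -[]; lia.
have -> : ((s, m) == (i + nleaves l1, nleaves l2 + nleaves r)) = false.
  by apply/eqP=> -[]; lia.
by rewrite /= !orbA.
Qed.

Lemma mem_pairs n (t : ptree n) s m : s + m < n -> 1 < m ->
  (itv n s m \in parenthesis_pairs t) = ((s, m) \in spans 0 t).
Proof.
move=> h m1; rewrite inE card_itv_gt1 // m1 andbT.
by apply: mem_RP_spans => //; lia.
Qed.

Lemma pairs_pred n (t : ptree n) : 0 < #|parenthesis_pairs t| ->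
  exists2 u : ptree n, (u < t)%O &
    #|parenthesis_pairs t| = #|parenthesis_pairs u|.+1.
Proof.
have et := eqP (tree_ofP t).
case/card_gt0P=> A0; rewrite inE => /andP [/mem_RP_itv [s1 [m1]]].
case=> m10 hs1 -> hm1; rewrite card_itv_gt1 // => m11.
case: (rotate 0 t) => [H|[u [s0 [m0 []]]]].
  by have := H _ _ _ hm1; rewrite add0n et => /(_ hs1); lia.
rewrite add0n et => eu m01 hsm hn H.
pose v : ptree n := PTree (introT eqP eu).
have nI : itv n s0 m0 \notin parenthesis_pairs v by rewrite mem_pairs.
have E : parenthesis_pairs t = itv n s0 m0 |: parenthesis_pairs v.
  apply/setP=> A; rewrite in_setU1; apply/idP/orP.
    move=> hA; move: (hA); rewrite inE => /andP [/mem_RP_itv [s [m]]].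
    case=> _ h eA hm m2; rewrite eA card_itv_gt1 // in m2.
    move: hm; rewrite eA H // => /orP [/eqP [-> ->]|hm]; first by left.
    by right; rewrite mem_pairs.
  case=> [/eqP ->|]; first by rewrite mem_pairs // H // eqxx.
  rewrite [A \in parenthesis_pairs v]inE => /andP [/mem_RP_itv [s [m]]].
  case=> _ h -> hm; rewrite card_itv_gt1 // => m2.
  by rewrite mem_pairs // H // hm orbT.
exists v; last by rewrite E cardsU1 nI.
rewrite lt_leAnge -!pairs_sub E subsetUr /=; apply/negP => /subsetP.
by move/(_ (itv n s0 m0)); rewrite setU11 (negPf nI) => /(_ isT).
Qed.

Lemma rank_pairs n (t : ptree n) : rank t = #|parenthesis_pairs t|.
Proof.
apply/eqP; rewrite eqn_leq; apply/andP; split.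
  apply/bigmax_leqP => C /andP [/forall_inP below /forall_inP chain].
  pose f (y : ptree n) : 'I_(#|parenthesis_pairs t|.+1) :=
    inord #|parenthesis_pairs y|.
  have fE y : y \in C -> f y = #|parenthesis_pairs y| :> nat.
    move=> /below yt; rewrite inordK // ltnS subset_leq_card //.
    by rewrite pairs_sub.
  have inj : {in C &, injective f}.
    move=> y z hy hz /(congr1 val) /=; rewrite fE // fE // => e.
    have /forall_inP /(_ z hz) := chain y hy.
    by case: comparableP => // /card_pairs_lt; rewrite e ltnn.
  have := max_card (f @: C); rewrite card_in_imset // card_ord.
  by case: #|C|.
suff [C hC cC] : exists2 C : {set ptree n}, [forall y in C, (y <= t)%O]
    && [forall y in C, forall z in C, (y >=< z)%O]
    & #|C| = #|parenthesis_pairs t|.+1.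
  apply: leq_trans (leq_bigmax_cond (F := fun C : {set _} => #|C|.-1) C hC).
  by rewrite cC.
move e : #|parenthesis_pairs t| => p; elim: p t e => [|p IH] t e.
  exists [set t]; last by rewrite cards1.
  apply/andP; split; first by apply/forall_inP => y /set1P ->.
  apply/forall_inP => y /set1P ->; apply/forall_inP => z /set1P ->.
  exact: comparablexx.
have [|u ut eu] := @pairs_pred _ t; first by rewrite e.
have [|C /andP [/forall_inP below /forall_inP chain] cC] := IH u.
  by rewrite eu in e; case: e.
have bt y : y \in C -> (y <= t)%O.
  by move/below => h; apply: le_trans h (ltW ut).
exists (t |: C); last first.
  rewrite cardsU1 cC; case: (boolP (t \in C)) => // /below h.
  by move: (lt_le_trans ut h); rewrite ltxx.
apply/andP; split; apply/forall_inP => y /setU1P [->|hy] //; rewrite ?bt //.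
  apply/forall_inP => z /setU1P [->|hz]; first exact: comparablexx.
  by apply: ge_comparable; apply: bt.
apply/forall_inP => z /setU1P [->|hz]; first by apply: le_comparable; apply: bt.
by have /forall_inP := chain y hy; apply.
Qed.

(* A labeling of all the vertices of t by {0, 1, 2}. *)
Fixpoint labeling (t : bintree) : finType :=
  if t is Node l r then ('I_3 * (labeling l * labeling r))%type else 'I_3.

Definition root_label (t : bintree) : labeling t -> 'I_3 :=
  match t with Leaf => fun L => L | Node _ _ => fun L => L.1 end.

Fixpoint leaf_word (t : bintree) : labeling t -> seq 'I_3 :=
  match t with
  | Leaf => fun L => [:: L]
  | Node l r => fun L => leaf_word L.2.1 ++ leaf_word L.2.2
  end.

Fixpoint proper (t : bintree) : labeling t -> bool :=
  match t with
  | Leaf => fun _ => true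
  | Node l r => fun L =>
      [&& root_label L.2.1 != root_label L.2.2,
          L.1 != root_label L.2.1, L.1 != root_label L.2.2,
          proper L.2.1 & proper L.2.2]
  end.

Definition parses (t : bintree) (w : seq 'I_3) : bool :=
  [exists L : labeling t, proper L && (leaf_word L == w)].

Definition ParseWords n (ts : seq (ptree n)) : {set n.-tuple 'I_3} :=
  [set w : n.-tuple 'I_3 | all (fun t : ptree n => parses t w) ts].

(* Main.v *)
(* Give the three labels the addition of the nonzero vectors of (Z/2)^2: the
   label of an internal vertex is the sum of the labels of its children, so the
   root label depends on the word only and not on the tree that parses it.

   If T <= T', write T' = Node L R'.  Then T arises from Node L R, for some
   R <= R', by unfolding vertices of L along the right spine: replacing
   Node (Node A B) R by Node A (Node B R) repeatedly.  When T and T' both parse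
   a word, and L and R' get the distinct labels a and b, the labels of A and B
   at an unfolded vertex are forced to be b and a + b, while every vertex which
   is not unfolded still leaves two choices.  So each unfolded vertex halves the
   number 3 * 2 ^ (n - 1) of words parsed by T', and k vertices are unfolded. *)
Require Import Defs.
From HB Require Import structures.
From mathcomp Require Import all_boot all_order.
From mathcomp Require Import zify.

Set Implicit Arguments.
Unset Strict Implicit.
Unset Printing Implicit Defensive.

(** * The relation [a + b = c] on labels seen as nonzero vectors of (Z/2)^2 *)

Definition tri (a b c : 'I_3) := [&& a != b, c != a & c != b].

Lemma triC a b c : tri a b c -> tri b a c.
Proof. by rewrite /tri eq_sym => /and3P [-> -> ->]. Qed.

Lemma tri_rot a b c : tri a b c -> tri b c a.
Proof.
by case/and3P=> h1 h2 h3; rewrite /tri h1 (eq_sym b) h3 (eq_sym a) h2.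
Qed.

Lemma tri_exists c : exists a b, tri a b c.
Proof.
case: c => [[|[|[|//]]] h].
- by exists (inord 1), (inord 2); rewrite /tri -!val_eqE /= !inordK.
- by exists (inord 0), (inord 2); rewrite /tri -!val_eqE /= !inordK.
- by exists (inord 0), (inord 1); rewrite /tri -!val_eqE /= !inordK.
Qed.

Lemma tri_cover a b c x : tri a b c -> [|| x == a, x == b | x == c].
Proof.
by case: a b c x => [[|[|[|//]]] ?] [[|[|[|//]]] ?] [[|[|[|//]]] ?] [[|[|[|//]]] ?].
Qed.

Lemma tri_cases a b c a' b' : tri a b c -> tri a' b' c ->
  (a' = a /\ b' = b) \/ (a' = b /\ b' = a).
Proof.
move=> h /and3P [h1 h2 h3].
have := tri_cover a' h; have := tri_cover b' h.
rewrite ![_ == c]eq_sym (negPf h2) (negPf h3) !orbF.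
move=> /orP [] /eqP eb /orP [] /eqP ea; rewrite ea eb; auto;
  by move: h1; rewrite ea eb eqxx.
Qed.

(* [c |-> (c != i)] is the character of (Z/2)^2 whose kernel is {0, i}. *)
Lemma tri_char a b c i : tri a b c -> (c != i) = (a != i) (+) (b != i).
Proof.
by case: a b c i => [[|[|[|//]]] ?] [[|[|[|//]]] ?] [[|[|[|//]]] ?] [[|[|[|//]]] ?].
Qed.

(** * Parsing with a prescribed root label *)

Definition parses_as (t : bintree) (w : seq 'I_3) (c : 'I_3) : bool :=
  [exists L : labeling t,
     [&& Defs.proper L, leaf_word L == w & root_label L == c]].

Lemma parses_ex t w : reflect (exists c, parses_as t w c) (parses t w).
Proof.
apply: (iffP existsP) => [[L /andP [h1 h2]]|[c /existsP [L /and3P [h1 h2 _]]]].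
  by exists (root_label L); apply/existsP; exists L; rewrite h1 h2 eqxx.
by exists L; rewrite h1 h2.
Qed.

Lemma size_leaf_word t (L : labeling t) : size (leaf_word L) = nleaves t.
Proof.
elim: t L => [|l IHl r IHr] //= [c [Ll Lr]] /=.
by rewrite size_cat IHl IHr.
Qed.

Lemma parses_as_size t w c : parses_as t w c -> size w = nleaves t.
Proof. by case/existsP=> L /and3P [_ /eqP <- _]; rewrite size_leaf_word. Qed.

Lemma parses_as_Leaf w c : parses_as Leaf w c = (w == [:: c]).
Proof.
apply/existsP/eqP => [[L /= /andP [/eqP <- /eqP ->]] //|->].
by exists c; rewrite /= !eqxx.
Qed.

Lemma parses_as_Node l r w v a b c : tri a b c ->
  parses_as l w a -> parses_as r v b -> parses_as (Node l r) (w ++ v) c.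
Proof.
case/and3P=> h1 h2 h3 /existsP [L /and3P [pL /eqP wL /eqP rL]].
case/existsP=> M /and3P [pM /eqP wM /eqP rM].
apply/existsP; exists (c, (L, M)) => /=.
by rewrite pL pM wL wM rL rM h1 h2 h3 !eqxx.
Qed.

Lemma parses_as_NodeP l r x c : parses_as (Node l r) x c ->
  exists a b, [/\ tri a b c, parses_as l (take (nleaves l) x) a &
                  parses_as r (drop (nleaves l) x) b].
Proof.
case/existsP=> -[c' [L M]] /= /and3P [/and5P [h1 h2 h3 pL pM] /eqP <- /eqP e].
subst c'; exists (root_label L), (root_label M).
rewrite -(size_leaf_word L) take_size_cat // drop_size_cat //.
split; first by rewrite /tri h1 h2 h3.
  by apply/existsP; exists L; rewrite pL !eqxx.
by apply/existsP; exists M; rewrite pM !eqxx.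
Qed.

(** By [tri_char] a character is additive at each internal vertex, so its value at the root is the
    sum over the leaves: the parity of the number of letters other than [i]. *)
Lemma parses_as_char t w c i : parses_as t w c ->
  odd (count (predC1 i) w) = (c != i).
Proof.
elim: t w c => [|l IHl r IHr] w c.
  by rewrite parses_as_Leaf => /eqP -> /=; rewrite addn0; case: (_ != _).
case/parses_as_NodeP=> a [b [h /IHl hl /IHr hr]].
by rewrite -(cat_take_drop (nleaves l) w) count_cat oddD hl hr (tri_char i h).
Qed.

(** The parities in [parses_as_char] do not involve the tree; the one at [d] already forces
    [c = d]. *)
Lemma parses_as_inj t u w c d : parses_as t w c -> parses_as u w d -> c = d.
Proof.
move=> /parses_as_char ht /parses_as_char hu; apply/eqP.
by move: (hu d); rewrite ht eqxx => /negbFE.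
Qed.

(** * Cardinality of predicates on words *)

Section HasCard.

Variable U : eqType.
Implicit Types P Q B : pred (seq U).

(** Stated with lists, since words of varying lengths are cut and concatenated along subtrees. *)
Definition has_card P k :=
  exists s : seq (seq U), [/\ uniq s, forall w, (w \in s) = P w & size s = k].

Lemma has_card_ext P Q k : P =1 Q -> has_card P k -> has_card Q k.
Proof.
by move=> e [s [h1 h2 h3]]; exists s; split=> // w; rewrite h2 e.
Qed.

Lemma has_card_pred0 P : P =1 pred0 -> has_card P 0.
Proof. by move=> e; exists [::]; split=> // w; rewrite e. Qed.

Lemma has_cardU P Q k m : has_card P k -> has_card Q m ->
  (forall w, P w -> Q w -> False) ->
  has_card (fun w => P w || Q w) (k + m).
Proof.
move=> [s [us sP <-]] [t [ut tQ <-]] dis; exists (s ++ t); split.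
- rewrite cat_uniq us ut andbT; apply/hasPn => w; rewrite tQ => hQ.
  by apply/negP; rewrite sP => hP; apply: (dis w).
- by move=> w; rewrite mem_cat sP tQ.
by rewrite size_cat.
Qed.

(** Count by fibres: the condition on the prefix may depend on the suffix [v], as happens when a
    tree straddles the cut. The fixed length [n] makes the cut unique. *)
Lemma has_card_cat (P : seq U -> pred (seq U)) B n k m :
  (forall v w, P v w -> size w = n) ->
  has_card B m -> (forall v, B v -> has_card (P v) k) ->
  has_card (fun x => P (drop n x) (take n x) && B (drop n x)) (k * m).
Proof.
move=> hP [s [us sB <-]] {m} H.
have {}H v : v \in s -> has_card (P v) k by rewrite sB; apply: H.
suff : has_card (fun x => P (drop n x) (take n x) && (drop n x \in s))
  (k * size s) by apply: has_card_ext => x; rewrite sB.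
elim: s us {B sB} H => [_ _|v s IH /= /andP [vs us] H].
  by rewrite muln0; apply: has_card_pred0 => x; rewrite andbF.
have [t [ut tP et]] := H v (mem_head _ _).
have h1 : has_card (fun x => P v (take n x) && (drop n x == v)) k.
  exists [seq w ++ v | w <- t]; split; last by rewrite size_map.
    rewrite map_inj_in_uniq // => w w'; rewrite !tP => /hP e /hP e' /eqP.
    by rewrite eqseq_cat ?e ?e' // => /andP [/eqP].
  move=> x; apply/mapP/andP => [[w + ->]|[h /eqP <-]].
    rewrite tP => h; have e := hP _ _ h.
    by rewrite take_size_cat // drop_size_cat.
  by exists (take n x); rewrite ?tP ?cat_take_drop.
have h2 := IH us (fun u hu => H u (@mem_behead _ (v :: s) u hu)).
rewrite mulnS; apply: has_card_ext (has_cardU h1 h2 _) => x.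
  rewrite inE; case: eqP => [->|_]; last by rewrite andbF.
  by rewrite (negPf vs) andbF orbF.
by move=> /andP [_ /eqP ->] /andP [_]; rewrite (negPf vs).
Qed.

End HasCard.

(** * Counting the words parsed by one tree, then by two *)

Lemma has_card_words t c : has_card (fun w => parses_as t w c) (2 ^ (nleaves t).-1).
Proof.
elim: t c => [|l IHl r IHr] c.
  by exists [:: [:: c]]; split=> // w; rewrite mem_seq1 parses_as_Leaf.
(* The children are labeled [(a, b)] or [(b, a)]: a factor 2 per internal vertex. *)
have [a [b h]] := tri_exists c.
have H x y : has_card (fun w => parses_as l (take (nleaves l) w) x &&
    parses_as r (drop (nleaves l) w) y) (2 ^ (nleaves l).-1 * 2 ^ (nleaves r).-1).
  apply: (has_card_cat (n := nleaves l) (P := fun _ w => parses_as l w x) _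
    (IHr y) (fun _ _ => IHl x)).
  by move=> _ w /parses_as_size.
have -> : (nleaves (Node l r)).-1 = ((nleaves l).-1 + (nleaves r).-1).+1.
  by have := nleaves_gt0 l; have := nleaves_gt0 r => /=; lia.
rewrite expnS expnD mul2n -addnn.
apply: has_card_ext (has_cardU (H a b) (H b a) _) => w; last first.
  case/andP=> h1 _ /andP [h2 _]; have e := parses_as_inj h1 h2.
  by move: h; rewrite /tri e eqxx.
apply/orP/idP => [[] /andP [h1 h2]|/parses_as_NodeP [x [y [h' h1 h2]]]].
- by rewrite -(cat_take_drop (nleaves l) w); apply: parses_as_Node h h1 h2.
- by rewrite -(cat_take_drop (nleaves l) w); apply: parses_as_Node (triC h) h1 h2.
by case: (tri_cases h h') => -[ex ey]; subst x y; [left|right]; rewrite h1 h2.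
Qed.

(* [unfolds L R T u]: T arises from Node L R by unfolding along the right spine
   all but u of the internal vertices of L. *)
Inductive unfolds : bintree -> bintree -> bintree -> nat -> Prop :=
| unfolds0 L R : unfolds L R (Node L R) (nleaves L).-1
| unfoldsS A B R X T u v : unfolds B R X u -> unfolds A X T v ->
    unfolds (Node A B) R T (u + v).

Lemma unfolds_nleaves L R T u : unfolds L R T u ->
  nleaves T = nleaves L + nleaves R.
Proof. by elim=> // A B R' X T' u' v _ -> _ -> /=; lia. Qed.

(** [R] survives as a subtree of [T] on the last leaves. *)
Lemma unfolds_parses L R T u w c : unfolds L R T u -> parses_as T w c ->
  exists b, parses_as R (drop (nleaves L) w) b.
Proof.
move=> H; elim: H w c => {L R T u} [L R|A B R X T u v _ IHB _ IHA] w c.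
  by case/parses_as_NodeP=> a [b [_ _ hb]]; exists b.
case/IHA=> x /IHB [b]; rewrite drop_drop => hb; exists b.
by rewrite /= addnC.
Qed.

(** Induction for all labels at once: at an unfolded vertex the triple [(a, b, c)] becomes
    [(c, b, a)] for [B] and [(b, a, c)] for [A], and the counts multiply with no extra factor 2. *)
Lemma has_card_unfolds L R T u : unfolds L R T u ->
  forall a b c v, tri a b c -> parses_as R v b ->
  has_card (fun w => parses_as L w a && parses_as T (w ++ v) c) (2 ^ u).
Proof.
elim=> {L R T u} [L R|A B R X T u u' hB IHB hA IHA] a b c v h hv.
  apply: has_card_ext (has_card_words L a) => w.
  by case hw: (parses_as L w a); rewrite //= (parses_as_Node h hw hv).
have hcba : tri c b a by apply: triC; apply: tri_rot.
rewrite expnD mulnC.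
apply: has_card_ext (has_card_cat (n := nleaves A)
  (P := fun wB wA => parses_as A wA b && parses_as T (wA ++ (wB ++ v)) c)
  _ (IHB c b a v hcba hv) _).
- move=> w; rewrite catA cat_take_drop.
  apply/idP/idP => [/andP [/andP [h1 ->] /andP [h2 h3]]|/andP [hw hT]].
    rewrite andbT -(cat_take_drop (nleaves A) w).
    exact: parses_as_Node (tri_rot h) h1 h2.
  have [x [y [hxy hx hy]]] := parses_as_NodeP hw.
  have [z] := unfolds_parses hA hT.
  have sA : nleaves A <= size w by rewrite (parses_as_size hw) leq_addr.
  have -> : drop (nleaves A) (w ++ v) = drop (nleaves A) w ++ v.
    rewrite -{1}(cat_take_drop (nleaves A) w) -catA drop_size_cat //.
    exact: size_takel.
  move=> hz.
  (* z is the sum of y and b, and it is not zero. *)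
  have Z i : (z != i) = (y != i) (+) (b != i).
    rewrite -(parses_as_char i hz) count_cat oddD.
    by rewrite (parses_as_char i hy) (parses_as_char i hv).
  (* If [y = b], every character vanishes at [z]; those at [a] and [b] give [z = a] and [z = b]. *)
  have yb : y != b.
    apply/eqP=> e; have := Z a; have := Z b; rewrite e !addbb.
    by move=> /negbFE/eqP -> /negbFE/eqP e'; move: h; rewrite /tri e' eqxx.
  have [ex ey] : x = b /\ y = c.
    have /or3P [/eqP e|/eqP e|/eqP e] := tri_cover y h.
    - by move: hxy; rewrite /tri e eqxx !andbF.
    - by rewrite e eqxx in yb.
    split=> //; have /or3P [/eqP e'|/eqP e'|/eqP e'] := tri_cover x h => //.
      by move: hxy; rewrite /tri e' eqxx andbF.
    by move: hxy; rewrite /tri e e' eqxx.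
  have /negbFE/eqP ez : (z != a) = false.
    by rewrite Z ey -(tri_char a hcba) eqxx.
  by subst x y z; rewrite hx hT hy hz.
- by move=> wB wA /andP [/parses_as_size].
by move=> wB /andP [_ hX]; apply: IHA (triC h) hX.
Qed.

(** The exponent counts the vertices of the second tree that keep two choices: [u] in [L], [e] in
    [R'], and the root. *)
Inductive refines : bintree -> bintree -> nat -> Prop :=
| refines_Leaf : refines Leaf Leaf 0
| refines_Node L R R' T u e : unfolds L R T u -> refines R R' e ->
    refines T (Node L R') (u + e).+1.

Lemma refines_nleaves T T' e : refines T T' e -> nleaves T = nleaves T'.
Proof. by elim=> // L R R' {}T u e' /unfolds_nleaves -> _ /= ->. Qed.

Lemma has_card_refines T T' e : refines T T' e -> forall c,
  has_card (fun w => parses_as T w c && parses_as T' w c) (2 ^ e).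
Proof.
elim=> {T T' e} [|L R R' T u e hT hR IH] c.
  by apply: has_card_ext (has_card_words Leaf c) => w; rewrite andbb.
have [a [b h]] := tri_exists c.
have H x y : tri x y c -> has_card (fun w =>
    (parses_as L (take (nleaves L) w) x && parses_as T w c) &&
    (parses_as R (drop (nleaves L) w) y && parses_as R' (drop (nleaves L) w) y))
    (2 ^ u * 2 ^ e).
  move=> hxy; apply: has_card_ext (has_card_cat (n := nleaves L)
    (P := fun v w => parses_as L w x && parses_as T (w ++ v) c) _ (IH y) _) => /=.
  - by move=> w; rewrite cat_take_drop.
  - by move=> v w /andP [/parses_as_size].
  by move=> v /andP [hv _]; apply: has_card_unfolds hv.
rewrite expnS expnD mul2n -addnn.
apply: has_card_ext (has_cardU (H a b h) (H b a (triC h)) _) => w; last first.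
  case/andP=> /andP [h1 _] _ /andP [/andP [h2 _] _].
  by have e' := parses_as_inj h1 h2; move: h; rewrite /tri e' eqxx.
apply/orP/idP => [[] /andP [/andP [h1 ->] /andP [h2 h3]]|/andP [h0]].
- by rewrite -(cat_take_drop (nleaves L) w); apply: parses_as_Node h h1 h3.
- by rewrite -(cat_take_drop (nleaves L) w); apply: parses_as_Node (triC h) h1 h3.
case/parses_as_NodeP => x [y [h' h1 h3]].
(* [R] and [R'] parse the same suffix, hence with the same root label. *)
have [z hz] := unfolds_parses hT h0.
have ez := parses_as_inj hz h3; subst z.
by case: (tri_cases h h') => -[ex ey]; subst x y; [left|right];
  rewrite h0 h1 hz h3.
Qed.

Lemma card_ParseWords n (T T' : ptree n) e : refines T T' e ->
  #|ParseWords [:: T; T']| = 3 * 2 ^ e.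
Proof.
move=> H.
have h c := has_card_refines H c.
(* [ord0], [a] and [b] are the three root labels; they split the words into disjoint classes. *)
have [a [b hab]] := tri_exists ord0.
have D x y w : x != y -> parses_as T w x && parses_as T' w x ->
    parses_as T w y && parses_as T' w y -> False.
  by move=> + /andP [h1 _] /andP [h2 _]; rewrite (parses_as_inj h1 h2) eqxx.
have [h1 h2 h3] := and3P hab.
have [s [us sP es]] : has_card (fun w => parses T w && parses T' w) (3 * 2 ^ e).
  rewrite mulSn mul2n -addnn.
  apply: has_card_ext (has_cardU (h ord0) (has_cardU (h a) (h b) _) _).
  - move=> w; apply/or3P/andP => [[]|].
    1-3: by case/andP=> *; split; apply/parses_ex; eexists; eassumption.
    case=> /parses_ex [x hx] /parses_ex [y hy].
    have exy := parses_as_inj hx hy; subst y.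
    have /or3P [] := tri_cover x hab => /eqP ex; subst x.
    - by constructor 2; rewrite hx.
    - by constructor 3; rewrite hx.
    by constructor 1; rewrite hx.
  - by move=> w; apply: D.
  by move=> w hw /orP [|]; apply: D hw.
rewrite -es cardE -(size_map val).
apply/perm_size/uniq_perm => // [|w].
  by rewrite map_inj_uniq ?enum_uniq //; apply: val_inj.
rewrite sP; apply/mapP/andP => [[w']|[hT hT']].
  by rewrite mem_enum inE /= andbT => /andP [hT hT'] ->.
have sw : size w == n.
  case/parses_ex: hT => c /parses_as_size ->; exact: tree_ofP.
by exists (Tuple sw) => //; rewrite mem_enum inE /= hT hT'.
Qed.

(** * Recovering the unfoldings from inclusion of spans *)

(** The spans of [l] and [r] occur in [u], and can only lie in [l'] and [r'] respectively, so both
    roots split at the same place. *)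
Lemma spans_sub_eq i t u : nleaves t = nleaves u ->
  {subset spans i t <= spans i u} -> t = u.
Proof.
elim: t i u => [|l IHl r IHr] i [|l' r'] //= e H.
- by have := nleaves_gt0 l'; have := nleaves_gt0 r'; lia.
- by have := nleaves_gt0 l; have := nleaves_gt0 r; lia.
have p1 := nleaves_gt0 l; have p2 := nleaves_gt0 r.
have p3 := nleaves_gt0 l'; have p4 := nleaves_gt0 r'.
have hl : (i, nleaves l) \in spans i (Node l' r').
  by apply: H; rewrite spans_Node_l ?spans_root.
have hr : (i + nleaves l, nleaves r) \in spans i (Node l' r').
  by apply: H; rewrite spans_Node_r ?spans_root.
have el : nleaves l = nleaves l'.
  move: hl; rewrite spans_Node inE mem_cat.
  case/or3P=> [/eqP []|/spans_bound []|/spans_bound []]; try lia.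
  move: hr; rewrite spans_Node inE mem_cat.
  by case/or3P=> [/eqP []|/spans_bound []|/spans_bound []]; lia.
congr Node.
  apply: (IHl i) => // -[s m] h; have [_ hb _] := spans_bound h.
  rewrite -(spans_Node_l r') -?el //; apply: H.
  by rewrite spans_Node_l.
apply: (IHr (i + nleaves l)) => [|[s m] h]; first by lia.
have [hb _ _] := spans_bound h.
rewrite el -(@spans_Node_r i l' r') -?el //; apply: H.
by rewrite spans_Node_r.
Qed.

Lemma unfolds_spans L R T u i : unfolds L R T u ->
  {subset spans (i + nleaves L) R <= spans i T}.
Proof.
move=> H; elim: H i => {L R T u} [L R|A B R X T u v _ IHB _ IHA] i [s m] h.
  by rewrite spans_Node_r //; case: (spans_bound h).
by apply: IHA; apply: IHB; rewrite -addnA.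
Qed.

(** The left child of [T] is either all of [L = Node A B], and nothing is unfolded, or it lies in
    [A]; then [T] unfolds [A] over some [X], which in turn unfolds [B]. *)
Lemma unfolds_exists i L T : nleaves L < nleaves T ->
  (forall s m, (s, m) \in spans i T -> s + m < i + nleaves T ->
     s < i + nleaves L -> (s, m) \in spans i L) ->
  exists R u, unfolds L R T u.
Proof.
elim: L i T => [|A IHA B IHB] i T /= hn H.
all: case: T hn H => [|TL TR] hn H; first by
  [|have := nleaves_gt0 A; have := nleaves_gt0 B; rewrite /= in hn; lia].
all: have pl := nleaves_gt0 TL; have pr := nleaves_gt0 TR.
all: have hl : (i, nleaves TL) \in spans i (Node TL TR)
  by rewrite spans_Node_l ?spans_root.
  have := H _ _ hl; rewrite inE /= => /(_ ltac:(lia) ltac:(lia)) /eqP [e].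
  case: TL e {hl H hn pl} => [|t1 t2] /= e.
    by exists TR, 0; apply: unfolds0 Leaf TR.
  by have := nleaves_gt0 t1; have := nleaves_gt0 t2; lia.
have pA := nleaves_gt0 A; have pB := nleaves_gt0 B; rewrite /= in hn H.
have := H _ _ hl ltac:(lia) ltac:(lia); rewrite spans_Node inE mem_cat.
case/or3P => [/eqP [e]|hA|/spans_bound []]; last by lia.
  suff -> : TL = Node A B by exists TR, (nleaves (Node A B)).-1; constructor.
  apply: (@spans_sub_eq i) => // -[s m] h; have [h1 h2 h3] := spans_bound h.
  by apply: H; try lia; rewrite spans_Node_l.
have [_ hAl _] := spans_bound hA.
have [|s m h hb hs|X [v hX]] := IHA i (Node TL TR) => /=; first by lia.
  rewrite /= in hb; have := H _ _ h ltac:(lia) ltac:(lia).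
  rewrite spans_Node inE mem_cat.
  case/or3P => [/eqP [es em]|//|/spans_bound []]; last by lia.
  (* The span of [L] is not in [T], whose left child fits inside [A]. *)
  move: h; rewrite es em spans_Node inE mem_cat.
  by case/or3P => [/eqP []|/spans_bound []|/spans_bound []]; lia.
have := unfolds_nleaves hX => /= eX.
have [|s m h hb hs|R [u hR]] := IHB (i + nleaves A) X; first by lia.
  have [h1 h2 h3] := spans_bound h.
  rewrite -(@spans_Node_r i A B) //; apply: H; try lia.
  exact: unfolds_spans hX _ h.
by exists R, (u + v); apply: unfoldsS hR hX.
Qed.

Lemma refines_exists i T T' : nleaves T = nleaves T' ->
  (forall s m, (s, m) \in spans i T -> s + m < i + nleaves T ->
     (s, m) \in spans i T') ->
  exists e, refines T T' e.
Proof.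
elim: T' i T => [|L _ R' IH] i T en H.
  case: T en {H} => [|l r] /= en; first by exists 0; constructor.
  by have := nleaves_gt0 l; have := nleaves_gt0 r; lia.
rewrite /= in en; have pL := nleaves_gt0 L; have pR := nleaves_gt0 R'.
have [|s m h hb hs|R [u hR]] := @unfolds_exists i L T; first by lia.
  have := H _ _ h hb; rewrite spans_Node inE mem_cat.
  by case/or3P => [/eqP []|//|/spans_bound []]; lia.
have eR := unfolds_nleaves hR.
have [|s m h hb|e he] := IH (i + nleaves L) R; first by lia.
  have [h1 h2 h3] := spans_bound h.
  rewrite -(@spans_Node_r i L R') //; apply: H; last by lia.
  exact: unfolds_spans hR _ h.
by exists (u + e).+1; apply: refines_Node hR he.
Qed.

(** * Rank and the exponent *)

(** Number of internal vertices off the right spine. *)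
Fixpoint off_spine (t : bintree) : nat :=
  if t is Node l r then (nleaves l).-1 + off_spine r else 0.

Lemma unfolds_off_spine L R T u : unfolds L R T u ->
  off_spine T = u + off_spine R.
Proof. by elim=> // A B R' X T' u' v _ -> _ ->; lia. Qed.

Lemma refines_off_spine T T' e : refines T T' e ->
  e + off_spine T' = (nleaves T).-1 + off_spine T.
Proof.
elim=> // L R R' {}T u {}e hT hR IH /=.
rewrite (unfolds_nleaves hT) (unfolds_off_spine hT).
by have := nleaves_gt0 L; have := nleaves_gt0 R; lia.
Qed.

Lemma uniq_spans i t : uniq (spans i t).
Proof.
elim: t i => [|l IHl r IHr] i //; rewrite spans_Node cons_uniq mem_cat.
rewrite cat_uniq IHl IHr /= andbT.
have pl := nleaves_gt0 l; have pr := nleaves_gt0 r.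
apply/andP; split.
  by apply/negP => /orP [] /spans_bound []; lia.
apply/hasPn => -[s m] /spans_bound [h1 h2 h3].
by apply/negP => /spans_bound []; lia.
Qed.

Lemma count_spans i t :
  count (fun p => 1 < p.2) (spans i t) = (nleaves t).-1.
Proof.
elim: t i => [|l IHl r IHr] i //; rewrite spans_Node /= count_cat IHl IHr.
by have := nleaves_gt0 l; have := nleaves_gt0 r; lia.
Qed.

(** A subtree avoids the last leaf exactly when its root is off the right spine. *)
Lemma count_spans_off_spine i t :
  count (fun p => (1 < p.2) && (p.1 + p.2 < i + nleaves t)) (spans i t)
  = off_spine t.
Proof.
elim: t i => [|l IHl r IHr] i //; rewrite spans_Node /= count_cat ltnn andbF.
rewrite -(count_spans i l) -(IHr (i + nleaves l)) add0n.
have pr := nleaves_gt0 r.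
congr (_ + _); apply: eq_in_count => -[s m] /spans_bound /= [h1 h2 h3].
  by rewrite andbC (_ : s + m < _) //; lia.
by rewrite addnA.
Qed.

Lemma itv_inj n s m s' m' : s + m < n -> s' + m' < n -> 1 < m -> 1 < m' ->
  itv n s m = itv n s' m' -> (s, m) = (s', m').
Proof.
move=> h h' m1 m1' /setP e.
have E j : j < n -> (s <= j < s + m) = (s' <= j < s' + m').
  by move=> hj; have := e (Ordinal hj); rewrite !inE.
(* Each interval contains the first and last points of the other. *)
have := E s; have := E s'; have := E (s + m).-1; have := E (s' + m').-1.
by move=> *; congr pair; lia.
Qed.

Lemma rank_off_spine n (t : ptree n) : rank t = off_spine t.
Proof.
rewrite rank_pairs -(count_spans_off_spine 0) -size_filter.
set f := filter _ _.
have fP s m : (s, m) \in f = [&& 1 < m, s + m < n & (s, m) \in spans 0 t].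
  by rewrite mem_filter /= (eqP (tree_ofP t)) -andbA.
rewrite -(size_map (fun p => itv n p.1 p.2)) cardE.
apply/perm_size/uniq_perm; first exact: enum_uniq.
  rewrite map_inj_in_uniq ?filter_uniq ?uniq_spans // => -[s m] [s' m'].
  by rewrite !fP => /and3P [h1 h2 _] /and3P [h3 h4 _] /=; apply: itv_inj.
move=> A; rewrite mem_enum; apply/idP/mapP => [|[[s m]]].
  rewrite inE => /andP [/mem_RP_itv [s [m [m0 h -> hm]]]].
  by rewrite card_itv_gt1 // => m1; exists (s, m); rewrite // fP m1 h.
by rewrite fP => /and3P [m1 h hm] ->; rewrite mem_pairs.
Qed.

Theorem theorem7p7 (n k : nat) (T T' : ptree n) :
  2 <= n ->
  (T < T')%O ->
  rank T' = rank T + k ->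
  #|ParseWords [:: T; T']| = 3 * 2 ^ (n - 1 - k).
Proof.
move=> _ /Order.POrderTheory.ltW TT'; rewrite !rank_off_spine => hk.
have [nT nT'] := (eqP (tree_ofP T), eqP (tree_ofP T')).
have [|s m h|e he] := @refines_exists 0 T T'; first by rewrite nT.
  rewrite add0n nT => hb; have [_ _ m0] := spans_bound h.
  by rewrite -mem_RP_spans //; apply: (subsetP TT'); rewrite mem_RP_spans.
rewrite (card_ParseWords he); congr (3 * 2 ^ _).
(* Here [e + k = n - 1], so the subtraction is not truncated. *)
by have := refines_off_spine he; rewrite nT hk; lia.
Qed.
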